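(* Let $f,h\in\mathrm{Homeo}_0(\mathbb{T}^2)$ commute ($fh=hf$), and let $\tilde f,\tilde h:\mathbb{R}^2\to\mathbb{R}^2$ be lifts of $f$ and $h$, respectively. If $\tilde f$ is $v$-annular for some $v\in\mathbb{Z}^2\setminus\{0\}$, then $\mathrm{Desv}_{v^{\bot}}(\tilde h)<\infty$ or $\mathrm{Desv}(\tilde f)<\infty$.
   Context: $\mathbb{T}^2=\mathbb{R}^2/\mathbb{Z}^2$, and $\mathrm{Homeo}_0(\mathbb{T}^2)$ denotes the set of homeomorphisms of $\mathbb{T}^2$ homotopic to the identity. A lift of $f\in\mathrm{Homeo}_0(\mathbb{T}^2)$ is a homeomorphism $\tilde f:\mathbb{R}^2\to\mathbb{R}^2$ that projects to $f$ under $\mathbb{R}^2\to\mathbb{T}^2$; it commutes with all integer translations. For $v=(a,b)\in\mathbb{R}^2$ write $v^{\bot}=(-b,a)$, and for $u\in\mathbb{R}^2\setminus\{0\}$ write $\mathrm{Pr}_u(x)=\frac{\langle x,u\rangle}{\|u\|}$. Annularity: for $v\in\mathbb{Z}^2\setminus\{0\}$, the lift $\tilde f$ is $v$-annular if there is $M>0$ such that $|\langle\tilde f^n(x)-x,v^{\bot}\rangle|\le M$ for every $x\in\mathbb{R}^2$ and every $n\in\mathbb{Z}$. Deviation: $$\mathrm{Desv}(\tilde f)=\sup_{n\in\mathbb{Z},\;x,y\in\mathbb{R}^2}\left\|(\tilde f^n(x)-x)-(\tilde f^n(y)-y)\right\|\in[0,\infty],$$ and for $u\in\mathbb{R}^2\setminus\{0\}$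 the deviation in the direction $u$ is $$\mathrm{Desv}_u(\tilde f)=\sup_{n\in\mathbb{Z},\;x,y\in\mathbb{R}^2}\left|\mathrm{Pr}_u\left[(\tilde f^n(x)-x)-(\tilde f^n(y)-y)\right]\right|\in[0,\infty].$$ The same definitions apply to $\tilde h$. *)

(* Defs.v *)
From HB Require Import structures.
From mathcomp Require Import all_boot all_order all_algebra generic_quotient.
From mathcomp Require Import all_classical all_reals all_analysis.

Set Implicit Arguments.
Unset Strict Implicit.
Unset Printing Implicit Defensive.

Import Order.TTheory GRing.Theory Num.Theory.
Import numFieldNormedType.Exports.

Local Open Scope classical_set_scope.
Local Open Scope ring_scope.
Local Open Scope quotient_scope.

Section Torus.
Context (R : realType).

Let torus_rel' (x y : R * R) :=
  (x.1 - y.1 \is a Num.int) && (x.2 - y.2 \is a Num.int).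

Local Lemma torus_rel_refl : reflexive torus_rel'.
Proof. by move=> x; rewrite /torus_rel' !subrr rpred0. Qed.

Local Lemma torus_rel_sym : symmetric torus_rel'.
Proof.
by move=> x y; rewrite /torus_rel' -(opprB x.1) -(opprB x.2) !rpredN.
Qed.

Local Lemma torus_rel_trans : transitive torus_rel'.
Proof.
move=> y x z /andP[xy1 xy2] /andP[yz1 yz2]; apply/andP; split.
- by rewrite -(subrKA y.1) rpredD.
- by rewrite -(subrKA y.2) rpredD.
Qed.

Definition torus_rel :=
  EquivRel _ torus_rel_refl torus_rel_sym torus_rel_trans.

Definition torus := {eq_quot torus_rel}.

HB.instance Definition _ := Topological.copy torus (quotient_topology torus).
HB.instance Definition _ := Quotient.on torus.

Definition torus_proj : R * R -> torus := \pi_torus.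

End Torus.

Record homeo (X : topologicalType) := Homeo {
  homeo_fun :> X -> X;
  homeo_inv : X -> X;
  homeo_funK : cancel homeo_fun homeo_inv;
  homeo_invK : cancel homeo_inv homeo_fun;
  homeo_fun_continuous : continuous homeo_fun;
  homeo_inv_continuous : continuous homeo_inv }.

(* [Negz n] denotes the integer -(n+1). *)
Definition iterz (X : topologicalType) (f : homeo X) (n : int) : X -> X :=
  match n with
  | Posz n => iter n f
  | Negz n => iter n.+1 (homeo_inv f)
  end.

Definition homotopic (R : realType) (X Y : topologicalType) (f g : X -> Y) :=
  exists H : R * X -> Y,
    [/\ {within `[0%R, 1%R]%classic `*` [set: X], continuous H},
        forall x, H (0, x) = f x
      & forall x, H (1, x) = g x].

Definition Homeo0 (R : realType) : set (homeo (torus R)) :=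
  [set f | homotopic R f idfun].

Definition is_lift (R : realType) (ft : homeo (R * R)%type)
    (f : homeo (torus R)) :=
  forall x, torus_proj (ft x) = f (torus_proj x).

Section Plane.
Context (R : realType).
Implicit Types (u x y : R * R) (f : homeo (R * R)%type) (n : int).

Definition dot x y : R := x.1 * y.1 + x.2 * y.2.

(* The library's norm [`|x|] on a product type is the maximum norm. *)
Definition enorm x : R := Num.sqrt (dot x x).

Definition perp u : R * R := (- u.2, u.1).

Definition Pr u x : R := dot x u / enorm u.

Definition vec_of_int (v : int * int) : R * R := (v.1%:~R, v.2%:~R).

Definition annular (v : int * int) f :=
  exists2 M : R, 0 < M &
    forall x n, `|dot (iterz f n x - x) (perp (vec_of_int v))| <= M.

Definition Desv f : \bar R :=
  ereal_sup [set d | exists n x y,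
    d = (enorm ((iterz f n x - x) - (iterz f n y - y)))%:E].

Definition Desv_dir u f : \bar R :=
  ereal_sup [set d | exists n x y,
    d = `|Pr u ((iterz f n x - x) - (iterz f n y - y))|%:E].

End Plane.

(* Main.v *)
Require Import Defs.
From mathcomp Require Import all_boot all_order all_algebra generic_quotient.
From mathcomp Require Import all_classical all_reals all_analysis.
From mathcomp Require Import ring lra.

Import Order.TTheory GRing.Theory Num.Theory.
Import numFieldNormedType.Exports.

Local Open Scope classical_set_scope.
Local Open Scope ring_scope.

(** Call height of a point its scalar product with the orthogonal of [v]. The
    iterates of the annular lift [ft] change heights by at most [M].

    Suppose that the iterates of [ht] have unbounded deviation in height. Then
    some iterate [G] of [ht] raises a point [x] of height at most 0 far above the
    image of a point [y] of height more than [M]. Consider the image [alpha]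
    under [G] of a vertical ray going down from [x] and the image [beta] of a
    vertical ray going up from [y]. The heights reached by the two paths overlap
    in a wide band. No iterate of [ft] moves [alpha] onto a point of [beta],
    or of a translate of [beta] by an integral vector parallel to [v]: since [G]
    commutes with the iterates of [ft] up to such vectors, this would mean moving
    a point of height at most 0 to a height above [M]. Hence the translates of
    [beta] are barriers that the part of [alpha] in the band cannot cross
    under the iterates of [ft], and the images of the translates of [alpha]
    are in turn barriers for the images of the horizontal segments that start
    on [alpha]. All points are therefore moved by the same amount along [v] up
    to a constant independent of the iterate ([uniform_deviation]), and as
    heights move by at most [M], the deviation of [ft] is finite.

    Two facts of plane topology support this. That barriers cannot be crossed is
    the lemma [paths_cross], a case of the Poincare-Miranda theorem. That lifts of
    homeomorphisms homotopic to the identity commute with integral translations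
    ([lift_commutes_with_translations]) comes from following the image of a loop
    along the homotopy. Both are derived from one lifting lemma, [angle_lift].
    Finally, [ft] and [ht] commute up to one integral vector because their two
    compositions lift the same map of the torus, and this vector is parallel to
    [v] because [ft] is annular ([commutator_along]). *)

(** * Continuous angles on the unit square *)

Section Continuity.
Context {T U V : topologicalType}.

Lemma comp_continuous (f : T -> U) (g : U -> V) :
  continuous f -> continuous g -> continuous (fun x => g (f x)).
Proof. by move=> cf cg x; apply: (cvg_comp _ _ (cf x)); exact: cg. Qed.

Lemma pair_continuous (f : T -> U) (g : T -> V) :
  continuous f -> continuous g -> continuous (fun x => (f x, g x)).
Proof.
move=> cf cg x; apply: (@cvg_pair _ _ _ _ (nbhs (f x)) (nbhs (g x))).
  exact: cf.
exact: cg.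
Qed.

Lemma fst_continuous (f : T -> U * V) :
  continuous f -> continuous (fun x => (f x).1).
Proof. by move=> cf x; apply: (cvg_comp _ _ (cf x)); exact: cvg_fst. Qed.

Lemma snd_continuous (f : T -> U * V) :
  continuous f -> continuous (fun x => (f x).2).
Proof. by move=> cf x; apply: (cvg_comp _ _ (cf x)); exact: cvg_snd. Qed.

Lemma id_continuous : continuous (fun x : T => x).
Proof. by move=> x; exact: cvg_id. Qed.

End Continuity.

Section RealContinuity.
Context {R : realType} {T : topologicalType}.
Implicit Types f g : T -> R.

Lemma realD_continuous f g :
  continuous f -> continuous g -> continuous (fun x => f x + g x).
Proof. by move=> cf cg x; apply: cvgD; [exact: cf|exact: cg]. Qed.

Lemma realB_continuous f g :
  continuous f -> continuous g -> continuous (fun x => f x - g x).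
Proof. by move=> cf cg x; apply: cvgB; [exact: cf|exact: cg]. Qed.

Lemma realM_continuous f g :
  continuous f -> continuous g -> continuous (fun x => f x * g x).
Proof. by move=> cf cg x; apply: cvgM; [exact: cf|exact: cg]. Qed.

End RealContinuity.

Section Lifting.
Context {R : realType}.

Definition clamp01 (x : R) : R := Num.max 0 (Num.min 1 x).

Lemma clamp01_ge0 x : 0 <= clamp01 x.
Proof. by rewrite /clamp01 le_max lexx. Qed.

Lemma clamp01_le1 x : clamp01 x <= 1.
Proof. by rewrite /clamp01 ge_max ler01 ge_min lexx. Qed.

Lemma clamp01_id x : 0 <= x <= 1 -> clamp01 x = x.
Proof.
by move=> /andP[x0 x1]; rewrite /clamp01 (min_idPr x1) (max_idPr x0).
Qed.

Lemma clamp01_continuous : continuous clamp01.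
Proof.
move=> x; apply: continuous_max; first exact: cst_continuous.
by apply: continuous_min; [exact: cst_continuous|exact: cvg_id].
Qed.

(** Retracting the plane onto the unit square turns maps that matter only on
    the square into maps on the plane, and continuity within a subset into
    plain continuity. *)
Definition clamp_square (p : R * R) : R * R := (clamp01 p.1, clamp01 p.2).

Lemma clamp_square_continuous : continuous clamp_square.
Proof.
by apply: pair_continuous;
  (apply: comp_continuous; last exact: clamp01_continuous);
  [apply: fst_continuous|apply: snd_continuous]; exact: id_continuous.
Qed.

Lemma clamp_squareK p : clamp_square (clamp_square p) = clamp_square p.
Proof.
have cl01 x : 0 <= clamp01 x <= 1 by rewrite clamp01_ge0 clamp01_le1.
by rewrite /clamp_square /= !(clamp01_id (clamp01 _) (cl01 _)).
Qed.

(** Two vectors less than a right angle apart: the arctangent of the ratio of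
    their cross product to their dot product is the angle between them, and it
    depends continuously on both. *)
Lemma angle_step (c s c' s' r th : R) :
  0 < r -> c = r * cos th -> s = r * sin th -> 0 < c * c' + s * s' ->
  let a := atan ((c * s' - s * c') / (c * c' + s * s')) in
  exists2 r', 0 < r' & c' = r' * cos (th + a) /\ s' = r' * sin (th + a).
Proof.
move=> r0 ec es d0 a.
set d := c * c' + s * s' in d0 a *; set w := c * s' - s * c' in a *.
have ca : 0 < cos a by apply: cos_gt0_pihalf; rewrite atan_gtNpi2 atan_ltpi2.
have sa : sin a = cos a * (w / d).
  have := atanK (w / d); rewrite /tan -/a => <-.
  by field; rewrite gt_eqF.
exists (d / cos a / r); first by rewrite !divr_gt0.
have rn : r != 0 by rewrite gt_eqF.
have dn : d != 0 by rewrite gt_eqF.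
have cn : cos a != 0 by rewrite gt_eqF.
have e2 : cos th ^+ 2 + sin th ^+ 2 = 1 by exact: cos2Dsin2.
rewrite cosD sinD sa; split.
- transitivity ((c * d - s * w) / r ^+ 2); last first.
    by rewrite ec es; field; rewrite rn cn dn.
  rewrite /d /w ec es.
  transitivity (c' * (cos th ^+ 2 + sin th ^+ 2)); first by rewrite e2 mulr1.
  by field.
- transitivity ((s * d + c * w) / r ^+ 2); last first.
    by rewrite ec es; field; rewrite rn cn dn.
  rewrite /d /w ec es.
  transitivity (s' * (cos th ^+ 2 + sin th ^+ 2)); first by rewrite e2 mulr1.
  by field.
Qed.

Lemma polar_angle (c s : R) : 0 < c ^+ 2 + s ^+ 2 ->
  exists th, exists2 r, 0 < r & c = r * cos th /\ s = r * sin th.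
Proof.
move=> cs0.
have [c0|c0|c0] := ltgtP c 0.
- have [|||r r0 [ec es]] := @angle_step (-1) 0 c s 1 pi ltr01.
  + by rewrite cospi mul1r.
  + by rewrite sinpi mulr0.
  + lra.
  by exists (pi + atan ((-1 * s - 0 * c) / (-1 * c + 0 * s))), r.
- have [|||r r0 [ec es]] := @angle_step 1 0 c s 1 0 ltr01.
  + by rewrite cos0 mul1r.
  + by rewrite sin0 mulr0.
  + lra.
  by exists (0 + atan ((1 * s - 0 * c) / (1 * c + 0 * s))), r.
- move: cs0; rewrite c0 expr0n add0r => s0.
  exists (if 0 < s then pi / 2 else - (pi / 2)), `|s|.
    by rewrite normr_gt0; apply: contraTneq s0 => ->; rewrite expr0n ltxx.
  case: ltP => h; first by rewrite cos_pihalf sin_pihalf mulr0 mulr1 gtr0_norm.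
  by rewrite cosN sinN cos_pihalf sin_pihalf mulr0 mulrN1 ler0_norm// opprK.
Qed.

(** The square is star-shaped about the origin, so the angle at the origin can
    be continued along the rays; by compactness finitely many steps of less than
    a right angle suffice for all rays at once. *)
Lemma angle_lift (C S : R * R -> R) :
  continuous C -> continuous S -> (forall p, 0 < C p ^+ 2 + S p ^+ 2) ->
  exists2 th : R * R -> R, continuous th &
    forall p, exists2 r, 0 < r &
      C (clamp_square p) = r * cos (th p) /\
      S (clamp_square p) = r * sin (th p).
Proof.
move=> cC cS CS0.
pose sc (t : R) (p : R * R) : R * R := (t * p.1, t * p.2).
pose d (q q' : R * R) := C q * C q' + S q * S q'.
pose w (q q' : R * R) := C q * S q' - S q * C q'.
have sc_cont (T : topologicalType) (t : T -> R) (p : T -> R * R) :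
    continuous t -> continuous p -> continuous (fun x => sc (t x) (p x)).
  move=> ct cp; apply: pair_continuous; apply: realM_continuous => //.
    exact: fst_continuous.
  exact: snd_continuous.
have dw_cont (T : topologicalType) (u u' : T -> R * R) :
    continuous u -> continuous u' ->
    continuous (fun x => d (u x) (u' x)) /\
    continuous (fun x => w (u x) (u' x)).
  move=> cu cu'; split.
    by apply: realD_continuous; apply: realM_continuous; apply: comp_continuous.
  by apply: realB_continuous; apply: realM_continuous; apply: comp_continuous.
(* Uniform continuity, in the only form needed: points [t p] and [(t + 1/N) p]
   of one ray from the origin have images less than a right angle apart as soon
   as [N] is large. *)
have [e e0 he] : exists2 e : R, 0 < e & forall N : nat, (N.+1%:R : R)^-1 < e ->
    forall t p, 0 <= t <= 1 -> 0 <= p.1 <= 1 -> 0 <= p.2 <= 1 ->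
    0 < d (sc t p) (sc (t + N.+1%:R^-1) p).
  have cK : compact (`[0%R, 1%R]%classic `*`
      (`[0%R, 1%R]%classic `*` `[0%R, 1%R]%classic) : set (R * (R * R))%type).
    by apply: compact_setX; [|apply: compact_setX]; exact: segment_compact.
  move/compact_near_coveringP : cK.
  move=> /(_ R (nbhs (0 : R)) (fun e tp =>
      0 < d (sc tp.1 tp.2) (sc (tp.1 + e) tp.2)) _).
  case.
    move=> [t p] /= _.
    pose ct (z : (R * (R * R)) * R) := d (sc z.1.1 z.1.2) (sc (z.1.1 + z.2) z.1.2).
    have cct : continuous ct.
      have c1 : continuous (fun z : (R * (R * R)) * R => z.1).
        exact/fst_continuous/id_continuous.
      apply: (dw_cont _ _ _ _ _).1; apply: sc_cont.
      - exact: fst_continuous.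
      - exact: snd_continuous.
      - apply: realD_continuous; first exact: fst_continuous.
        exact/snd_continuous/id_continuous.
      - exact: snd_continuous.
    have ct0 : 0 < ct ((t, p), 0).
      by rewrite /ct /= addr0 /d -!expr2; exact: CS0.
    have : \forall z \near ((t, p), (0 : R)), 0 < ct z.
      by apply: (cvgr_gt _ (cct ((t, p), 0))).
    by [].
  move=> /= e e0 he; exists e => // N Ne t p t01 p1 p2.
  apply: (he _ _ (t, p)); last by rewrite /= !in_itv /= t01 p1 p2.
  by rewrite /ball_/= sub0r normrN ger0_norm.
have [N /(he N){}he] : exists N : nat, (N.+1%:R : R)^-1 < e.
  exists (Num.bound e^-1); rewrite invf_plt ?posrE//.
  apply: lt_trans (archi_boundP _) _; first by rewrite invr_ge0 ltW.
  by rewrite ltr_nat.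
have [th0 [r0 r0_gt0 [C0 S0]]] := polar_angle _ _ (CS0 (0, 0)).
pose cl := clamp_square; have ccl := clamp_square_continuous.
have cl1 p : 0 <= (cl p).1 <= 1 by rewrite clamp01_ge0 clamp01_le1.
have cl2 p : 0 <= (cl p).2 <= 1 by rewrite clamp01_ge0 clamp01_le1.
(* The angle at [p] adds up the small turns met on the way from the origin to
   [p] along the ray, which is cut into [N.+1] pieces. *)
pose q i p := sc (i%:R / N.+1%:R) (cl p).
have cq i : continuous (q i) by apply: sc_cont => // p; exact: cvg_cst.
pose a i p := atan (w (q i p) (q i.+1 p) / d (q i p) (q i.+1 p)).
pose th n p := th0 + \sum_(0 <= i < n) a i p.
have d0 i p : (i <= N)%N -> 0 < d (q i p) (q i.+1 p).
  move=> iN; rewrite /q -[in i.+1]addn1 natrD mulrDl mul1r; apply: he => //.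
  by rewrite divr_ge0//= ler_pdivrMr ?ltr0n// mul1r ler_nat ltnW.
have thP n p : (n <= N.+1)%N -> exists2 r, 0 < r &
    C (q n p) = r * cos (th n p) /\ S (q n p) = r * sin (th n p).
  elim: n => [_|n IHn nN].
    by exists r0 => //; rewrite /th big_geq// addr0 /q /sc !mul0r.
  have [r r_gt0 [Cn Sn]] := IHn (ltnW nN).
  have [r' r'0 H] := angle_step _ _ _ _ _ _ r_gt0 Cn Sn (d0 n p nN).
  by exists r'; rewrite // /th big_nat_recr//= addrA.
exists (th N.+1); last first.
  move=> p; have [r r_gt0 H] := thP N.+1 p (leqnn _); exists r => //.
  by move: H; rewrite /q divff ?pnatr_eq0// /sc !mul1r -surjective_pairing.
have ca i : (i <= N)%N -> continuous (a i).
  move=> iN p; apply: (@cvg_comp _ _ _ _ atan); last exact: continuous_atan.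
  have [cd cw] := dw_cont _ (q i) (q i.+1) (cq i) (cq i.+1).
  by apply: cvgM; [exact: cw|apply: cvgV; [rewrite gt_eqF ?d0|exact: cd]].
suff H n : (n <= N.+1)%N -> continuous (th n) by exact: H.
elim: n => [_|n IHn nN] p.
  rewrite (_ : th 0%N = cst th0); first exact: cst_continuous.
  by apply/funext => z; rewrite /th big_geq// addr0.
rewrite (_ : th n.+1 = fun z => th n z + a n z).
  by apply: cvgD; [apply: IHn; exact: ltnW|exact: ca].
by apply/funext => z; rewrite /th big_nat_recr//= addrA.
Qed.

End Lifting.

(** * Intermediate values, and crossing paths in the plane *)

Section RealLine.
Context {R : realType}.
Implicit Types g : R -> R.

Lemma intermediate_value g (a b v : R) : continuous g -> a <= b ->
  Num.min (g a) (g b) <= v <= Num.max (g a) (g b) ->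
  exists2 c : R, a <= c <= b & g c = v.
Proof.
move=> cg ab vab.
have cw : {within `[a, b], continuous g} by exact: continuous_subspaceT.
by have [c] := IVT ab cw vab; rewrite in_itv /= => cab gc; exists c.
Qed.


Lemma int_valued_constant g : continuous g ->
  (forall s, g s \is a Num.int) -> forall s t, g s = g t.
Proof.
move=> cg gi.
suff H s t : s <= t -> g s = g t.
  by move=> s t; case: (leP s t) => [/H//|/ltW/H].
move=> st; apply/eqP/negP => /negP gst.
have [m gm] := intrP (gi s); have [n gn] := intrP (gi t).
have mn : m != n by apply: contraNneq gst => mn; rewrite gm gn mn.
pose k : int := Num.min m n.
have [|c _ gc] := intermediate_value g s t (k%:~R + 2^-1) cg st.
  rewrite gm gn /k minEle maxEle !ler_int; case: (leP m n) => mn'.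
    have : (m + 1)%:~R <= n%:~R :> R by rewrite ler_int lezD1 lt_neqAle mn.
    by rewrite intrD; lra.
  have : (n + 1)%:~R <= m%:~R :> R by rewrite ler_int lezD1.
  by rewrite intrD; lra.
have [l gl] := intrP (gi c).
have H1 : k%:~R < l%:~R :> R by rewrite -gl gc; lra.
have H2 : l%:~R < (k + 1)%:~R :> R by rewrite -gl gc intrD; lra.
move: H1 H2; rewrite !ltr_int ltzD1 => H1 H2.
by move: (lt_le_trans H1 H2); rewrite ltxx.
Qed.

(** Besides the two times, the point is that in between the path stays in the
    band between the two levels. *)
Lemma crossing_interval g (A B T : R) : continuous g -> 0 <= T -> A < B ->
  B <= g 0 -> g T <= A ->
  exists s1 : R, exists2 s2 : R, 0 <= s1 <= s2 /\ s2 <= T &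
  [/\ g s1 = B, g s2 = A & forall s : R, s1 <= s <= s2 -> A <= g s <= B].
Proof.
move=> cg T0 AB g0 gT.
have closedg (P : set R) : closed P -> closed [set s | P (g s)].
  by move=> Pc; apply: (closed_comp _ Pc) => s _; exact: cg.
have cid (D : set R) : {within D, continuous (fun s : R => s)}.
  by apply: continuous_subspaceT; exact: id_continuous.
have compact_level u (P : set R) : closed P ->
    compact [set s | 0 <= s <= u /\ P (g s)].
  move=> Pc; rewrite (_ : mkset _ = `[0, u] `&` [set s | P (g s)]).
    apply: (subclosed_compact _ (@segment_compact _ 0 u)); last by move=> s [].
    by apply: closedI; [exact: interval_closed|exact: closedg].
  by apply/seteqP; split=> s /=; rewrite in_itv.
(* [s2] is the first time at which the level [A] is reached, and [s1] the last
   time before [s2] at which [g] is at the level [B]. *)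
have [|s2 /set_mem[/andP[s20 s2T] gs2] s2min] :=
    compact_EVT_min _ (compact_level T _ (closed_le (y:=A))) (cid _).
  by exists T; split; rewrite // T0 lexx.
have {}s2min s : 0 <= s -> s < s2 -> A < g s.
  move=> s0 ss2; rewrite ltNge; apply/negP => gsA.
  have : s2 <= s.
    by apply: s2min; apply/mem_set; rewrite /= s0 (le_trans (ltW ss2)).
  by rewrite leNgt ss2.
have [|s1 /set_mem[/andP[s10 s12] gs1] s1max] :=
    compact_EVT_max _ (compact_level s2 _ (closed_ge (y:=B))) (cid _).
  by exists 0; split; rewrite // s20 lexx.
have {}s1max s : s <= s2 -> s1 < s -> g s < B.
  move=> ss2 s1s; rewrite ltNge; apply/negP => gsB.
  have : s <= s1.
    by apply: s1max; apply/mem_set; rewrite /= ss2 (le_trans s10 (ltW s1s)).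
  by rewrite leNgt s1s.
simpl in gs1, gs2.
have s1s2 : s1 < s2.
  rewrite lt_neqAle s12 andbT; apply: contraTneq AB => e.
  by rewrite -leNgt (le_trans gs1)// e.
have g1 : g s1 = B.
  have [|c /andP[c1 c2] gc] := intermediate_value g s1 s2 B cg s12.
    by rewrite ge_min le_max gs1 (le_trans gs2 (ltW AB)) orbT.
  have [cs|cs] := leP c s1.
    by rewrite -gc; congr g; apply/le_anti; rewrite c1 cs.
  by move: (s1max c c2 cs); rewrite gc ltxx.
have g2 : g s2 = A.
  have [|c /andP[c1 c2] gc] := intermediate_value g s1 s2 A cg s12.
    by rewrite ge_min le_max gs2 (le_trans (ltW AB) gs1) orbT.
  have [cs|cs] := leP s2 c.
    by rewrite -gc; congr g; apply/le_anti; rewrite c2 cs.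
  by move: (s2min c (le_trans s10 c1) cs); rewrite gc ltxx.
exists s1, s2; rewrite ?s10 ?s12//; split=> // s /andP[ss1 ss2].
apply/andP; split.
  have [e|ss2'] := eqVneq s s2; first by rewrite e g2.
  by apply/ltW/s2min; rewrite ?(le_trans s10)// lt_neqAle ss2' ss2.
have [e|ss1'] := eqVneq s1 s; first by rewrite -e g1.
by apply/ltW/s1max => //; rewrite lt_neqAle ss1' ss1.
Qed.

Lemma bounded_on_unit g : continuous g ->
  exists2 C : R, 0 <= C & forall s : R, 0 <= s <= 1 -> `|g s| <= C.
Proof.
move=> cg.
have cn : {within `[0, 1], continuous (fun s => `|g s|)}.
  apply: continuous_subspaceT => s; apply: (cvg_comp _ _ (cg s)).
  exact: norm_continuous.
have [c _ H] := EVT_max ler01 cn.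
by exists `|g c| => // s s01; apply: H; rewrite in_itv.
Qed.

(** Along a path of angles in the upper half circle, passing from the right to
    the left means increasing the angle: cosine is decreasing there. *)
Lemma upper_half_turn g : continuous g ->
  (forall s, 0 < sin (g s)) -> 0 < cos (g 0) -> cos (g 1) < 0 -> g 0 < g 1.
Proof.
move=> cg sg c0 c1; rewrite ltNge; apply/negP; rewrite le_eqVlt.
case/orP => [/eqP e|g10]; first by move: c0; rewrite -e ltNge (ltW c1).
have [|xi xi01] := @MVT R cos (fun x => - sin x) _ _ g10.
  by apply: continuous_subspaceT => x; exact: continuous_cos.
move: xi01; rewrite in_itv /= => /andP[xi1 xi0].
have [|s _ gs] := intermediate_value g 0 1 xi cg ler01.
  by rewrite ge_min le_max (ltW xi1) (ltW xi0) orbT.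
have := sg s; rewrite gs => sx /eqP; rewrite eq_le => /andP[+ _].
have : 0 < sin xi * (g 0 - g 1) by rewrite mulr_gt0// subr_gt0.
lra.
Qed.

End RealLine.

Section Crossing.
Context {R : realType}.

(** The Poincare-Miranda theorem in dimension two. Without a common zero,
    [(F, G)] would have a continuous angle on the square, while the sign
    conditions force it to make a full turn along the boundary. *)
Lemma poincare_miranda (F G : R * R -> R) :
  continuous F -> continuous G ->
  (forall s : R, 0 <= s <= 1 -> 0 < F (s, 0) /\ F (s, 1) < 0) ->
  (forall t : R, 0 <= t <= 1 -> G (0, t) < 0 /\ 0 < G (1, t)) ->
  exists s : R, exists2 t : R, 0 <= s <= 1 /\ 0 <= t <= 1 &
    F (s, t) = 0 /\ G (s, t) = 0.
Proof.
move=> cF cG F01 G01; apply: contrapT => noz.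
have cl01 (x : R) : 0 <= clamp01 x <= 1 by rewrite clamp01_ge0 clamp01_le1.
have [th cth thP] : exists2 th : R * R -> R, continuous th &
    forall p, exists2 r, 0 < r &
      F (clamp_square p) = r * cos (th p) /\
      G (clamp_square p) = r * sin (th p).
  have [|||th cth thP] := angle_lift
    (fun p => F (clamp_square p)) (fun p => G (clamp_square p)).
  - exact: comp_continuous clamp_square_continuous cF.
  - exact: comp_continuous clamp_square_continuous cG.
  - move=> p; rewrite lt_neqAle eq_sym paddr_eq0 ?sqr_ge0// !sqrf_eq0.
    rewrite addr_ge0 ?sqr_ge0// andbT; apply/negP => /andP[/eqP F0 /eqP G0].
    by apply: noz; exists (clamp01 p.1), (clamp01 p.2).
  by exists th => // p; have [r r0] := thP p; rewrite clamp_squareK; exists r.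
have c0 : clamp01 0 = 0 :> R by rewrite clamp01_id// lexx ler01.
have c1 : clamp01 1 = 1 :> R by rewrite clamp01_id// lexx ler01.
have bottom s : 0 < cos (th (s, 0)).
  have [r r0] := thP (s, 0); rewrite /clamp_square /= c0 => -[e _].
  by have [+ _] := F01 _ (cl01 s); rewrite e pmulr_rgt0.
have top s : cos (th (s, 1)) < 0.
  have [r r0] := thP (s, 1); rewrite /clamp_square /= c1 => -[e _].
  by have [_] := F01 _ (cl01 s); rewrite e pmulr_rlt0.
have left_ t : sin (th (0, t)) < 0.
  have [r r0] := thP (0, t); rewrite /clamp_square /= c0 => -[_ e].
  by have [+ _] := G01 _ (cl01 t); rewrite e pmulr_rlt0.
have right_ t : 0 < sin (th (1, t)).
  have [r r0] := thP (1, t); rewrite /clamp_square /= c1 => -[_ e].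
  by have [_] := G01 _ (cl01 t); rewrite e pmulr_rgt0.
have cpath (a b : R -> R) : continuous a -> continuous b ->
    continuous (fun s => th (a s, b s)).
  by move=> ca cb; apply: comp_continuous => //; exact: pair_continuous.
have cc (a : R) : continuous (fun _ : R => a) by move=> ?; exact: cvg_cst.
have cid : continuous (fun s : R => s) by exact: id_continuous.
have crev : continuous (fun s : R => 1 - s) by exact: realB_continuous (cc 1) cid.
(* Going once around the boundary, each side takes the vector [(F, G)] from one
   quadrant to the next without leaving a half plane, so the angle increases
   along each side; this is absurd after a full turn. *)
have AB : th (0, 0) < th (1, 0).
  have := upper_half_turn (fun s => th (s, 0) + pi / 2).
  rewrite !cosDpihalf ltrD2r !oppr_lt0 !oppr_gt0; apply=> //.
    by apply: realD_continuous => //; exact: cpath.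
  by move=> s; rewrite sinDpihalf.
have BC : th (1, 0) < th (1, 1).
  by apply: (upper_half_turn (fun t => th (1, t))) => //; exact: cpath.
have CD : th (1, 1) < th (0, 1).
  have := upper_half_turn (fun s => th (1 - s, 1) - pi / 2).
  rewrite !cosBpihalf ltrD2r subr0 subrr; apply=> //.
    by apply: realB_continuous => //; exact: cpath.
  by move=> s; rewrite sinBpihalf oppr_gt0.
have DA : th (0, 1) < th (0, 0).
  have := upper_half_turn (fun t => th (0, 1 - t) + pi).
  rewrite !cosDpi ltrD2r subr0 subrr oppr_gt0 oppr_lt0; apply=> //.
    by apply: realD_continuous => //; exact: cpath.
  by move=> s; rewrite sinDpi oppr_gt0.
by move: (lt_trans (lt_trans AB BC) (lt_trans CD DA)); rewrite ltxx.
Qed.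

(** A path [(a1, a2)] from the bottom to the top of a rectangle meets a path
    [(b1, b2)] from its left side to its right side: this is the common zero of
    the coordinates of [a s - b t]. *)
Lemma paths_cross (a1 a2 b1 b2 : R -> R) :
  continuous a1 -> continuous a2 -> continuous b1 -> continuous b2 ->
  (forall s t : R, 0 <= s <= 1 -> 0 <= t <= 1 ->
    [/\ a2 0 < b2 t, b2 t < a2 1, b1 0 < a1 s & a1 s < b1 1]) ->
  exists s : R, exists2 t : R, 0 <= s <= 1 /\ 0 <= t <= 1 &
    a1 s = b1 t /\ a2 s = b2 t.
Proof.
move=> ca1 ca2 cb1 cb2 H.
have c1 : continuous (fun p : R * R => p.1) by exact/fst_continuous/id_continuous.
have c2 : continuous (fun p : R * R => p.2) by exact/snd_continuous/id_continuous.
have cdiff (u v : R -> R) : continuous u -> continuous v ->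
    continuous (fun p : R * R => u p.1 - v p.2).
  by move=> cu cv; apply: realB_continuous; exact: comp_continuous.
have [||||s [t st [e1 e2]]] := poincare_miranda
  (fun p => a1 p.1 - b1 p.2) (fun p => a2 p.1 - b2 p.2).
- exact: cdiff.
- exact: cdiff.
- move=> s s01 /=; have [] := H s s s01 s01; lra.
- move=> t t01 /=; have [] := H t t t01 t01; lra.
by exists s, t => //; split; apply/eqP; rewrite -subr_eq0; apply/eqP.
Qed.

End Crossing.

(** * Lifts of maps of the torus *)

Section Trig.
Context {R : realType}.

Lemma cos_sin_int_periodic (x : R) (n : int) :
  cos (x + 2 * pi * n%:~R) = cos x /\ sin (x + 2 * pi * n%:~R) = sin x.
Proof.
have H (m : nat) y : cos (y + 2 * pi * m%:R) = cos y /\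
    sin (y + 2 * pi * m%:R) = sin y :> R.
  rewrite mulr_natl mulr_natr; split; apply: periodicn;
    [exact: cosD2pi|exact: sinD2pi].
case: n => m; first by have := H m x; rewrite -pmulrn.
rewrite NegzE intrN mulrN.
by have := H m.+1 (x - 2 * pi * m.+1%:R); rewrite subrK -pmulrn => -[-> ->].
Qed.


Lemma same_angle_int (a b : R) : cos a = cos b -> sin a = sin b ->
  (a - b) / (2 * pi) \is a Num.int.
Proof.
move=> ec es.
have pi0 : 0 < pi :> R := pi_gt0 R.
have cab : cos (a - b) = 1.
  by rewrite cosD cosN sinN ec es mulrN opprK -!expr2 cos2Dsin2.
set n := Num.floor ((a - b) / (2 * pi)).
set r := a - b + 2 * pi * (- n)%:~R.
have cr : cos r = 1 by rewrite /r (cos_sin_int_periodic _ _).1.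
have /andP[n1 n2] : n%:~R <= (a - b) / (2 * pi) < (n + 1)%:~R.
  exact: floor_itv.
have r0 : 0 <= r.
  move: n1; rewrite ler_pdivlMr ?mulr_gt0// /r intrN; lra.
have r1 : r < 2 * pi.
  move: n2; rewrite ltr_pdivrMr ?mulr_gt0// intrD /r intrN; lra.
have re0 : r = 0.
  apply/eqP; rewrite eq_le r0 andbT leNgt; apply/negP => rpos.
  have : 0 < sin (r / 2) by apply: sin_gt0_pi; apply/andP; split; lra.
  have : cos (r / 2 + r / 2) = 1 by rewrite -mulrDl -mulr2n -(mulr_natr r 2) mulfK.
  rewrite cosD -!expr2; have := cos2Dsin2 (r / 2).
  move=> e1 e2; have /eqP : sin (r / 2) ^+ 2 = 0 by lra.
  by rewrite sqrf_eq0 => /eqP ->; rewrite ltxx.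
have -> : (a - b) / (2 * pi) = n%:~R.
  have : a - b = 2 * pi * n%:~R by move: re0; rewrite /r intrN; lra.
  by move=> ->; rewrite mulrAC divff ?mul1r// gt_eqF// mulr_gt0.
exact: intr_int.
Qed.

End Trig.

Section Torus.
Context {R : realType}.
Implicit Types (x y : R * R) (w : int * int).

Lemma torus_projP x y : torus_proj x = torus_proj y <->
  (x.1 - y.1 \is a Num.int) /\ (x.2 - y.2 \is a Num.int).
Proof.
have -> : (torus_proj x = torus_proj y) <-> torus_rel R x y.
  by split => [/eqmodP//|H]; apply/eqmodP.
by split => [/andP|[? ?]]; last by apply/andP.
Qed.

Lemma torus_proj_continuous : continuous (@torus_proj R).
Proof. exact: pi_continuous. Qed.

Lemma torus_projD x w : torus_proj (x + vec_of_int R w) = torus_proj x.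
Proof.
apply/torus_projP; rewrite /= ![_ + _ - _]addrAC !subrr !add0r.
by split; exact: intr_int.
Qed.

Definition seg x y (s : R) : R * R := (x.1 + s * y.1, x.2 + s * y.2).

Lemma seg0 x y : seg x y 0 = x.
Proof. by rewrite /seg !mul0r !addr0; case: x. Qed.

Lemma seg1 x y : seg x y 1 = x + y.
Proof. by rewrite /seg !mul1r. Qed.

Lemma seg_continuous (T : topologicalType) x y (s : T -> R) :
  continuous s -> continuous (fun z => seg x y (s z)).
Proof.
move=> cs; have cc (a : R) : continuous (fun _ : T => a) by move=> ?; exact: cvg_cst.
by apply: pair_continuous; apply: realD_continuous => //; apply: realM_continuous.
Qed.

Lemma within_comp_continuous (T U V : topologicalType) (A : set U)
    (g : U -> V) (u : T -> U) :
  {within A, continuous g} -> continuous u -> (forall z, A (u z)) ->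
  continuous (fun z => g (u z)).
Proof.
move=> /subspace_continuousP cg cu Au z.
apply: (@cvg_comp _ _ _ u g _ (within A (nbhs (u z)))); last exact: cg.
move=> P AP; have H : nbhs z (fun k => A (u k) -> P (u k)) := cu z _ AP.
by apply: (filterS _ H) => y; apply; exact: Au.
Qed.

(** The functional [pr] stands for either coordinate. Along the homotopy from
    [f] to the identity, the segment from [x] to [x + w] has a loop as image;
    the variation of the lifted coordinate along this loop is the same at all
    times, and it is [pr w] at the end, where the map is the identity. The
    coordinate of a point of the torus is followed through its cosine and sine,
    which are continuous functions on the quotient. *)
Lemma homotopic_lift_translation (f : torus R -> torus R) (F : R * R -> R * R)
    (pr : R * R -> R) x w :
  homotopic R f idfun -> continuous F ->
  (forall z, torus_proj (F z) = f (torus_proj z)) ->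
  continuous pr -> (forall y z s, pr (seg y z s) = pr y + s * pr z) ->
  (forall y z, torus_proj y = torus_proj z -> pr y - pr z \is a Num.int) ->
  pr (F (x + vec_of_int R w)) = pr (F x) + pr (vec_of_int R w).
Proof.
move=> [H [cH H0 H1]] cF Ff cpr pr_seg pr_int.
have pi2 : 2 * pi != 0 :> R by rewrite lt0r_neq0// mulr_gt0// pi_gt0.
have cid (T : topologicalType) : continuous (fun z : T => z) by exact: id_continuous.
have cc (T U : topologicalType) (a : U) : continuous (fun _ : T => a).
  by move=> ?; exact: cvg_cst.
pose c (p : torus R) : R := cos (2 * pi * pr (repr p)).
pose s (p : torus R) : R := sin (2 * pi * pr (repr p)).
have cs_proj z : c (torus_proj z) = cos (2 * pi * pr z) /\
    s (torus_proj z) = sin (2 * pi * pr z).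
  have /pr_int/intrP[n e] : torus_proj (repr (torus_proj z)) = torus_proj z.
    exact: reprK.
  have {}e : 2 * pi * pr (repr (torus_proj z)) = 2 * pi * pr z + 2 * pi * n%:~R.
    by rewrite -e; ring.
  by rewrite /c /s e; exact: cos_sin_int_periodic.
have cc1 : continuous c.
  apply/quotient_continuous; rewrite (_ : _ \o _ = fun z => cos (2 * pi * pr z)).
    apply: comp_continuous; last exact: continuous_cos.
    by apply: realM_continuous => //; exact: cc.
  by apply/funext => z; exact: (cs_proj z).1.
have cs1 : continuous s.
  apply/quotient_continuous; rewrite (_ : _ \o _ = fun z => sin (2 * pi * pr z)).
    apply: comp_continuous; last exact: continuous_sin.
    by apply: realM_continuous => //; exact: cc.
  by apply/funext => z; exact: (cs_proj z).2.
pose y := vec_of_int R w.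
pose K (p : R * R) := H (clamp01 p.2, torus_proj (seg x y p.1)).
have cK : continuous K.
  apply: (within_comp_continuous _ _ _ _ H
      (fun p => (clamp01 p.2, torus_proj (seg x y p.1))) cH).
    apply: pair_continuous; apply: comp_continuous.
    - exact: snd_continuous.
    - exact: clamp01_continuous.
    - by apply: seg_continuous; exact: fst_continuous.
    - exact: torus_proj_continuous.
  by move=> p; split => //=; rewrite in_itv /= clamp01_ge0 clamp01_le1.
have [|||th cth thP] := angle_lift (fun p => c (K p)) (fun p => s (K p)).
- exact: comp_continuous.
- exact: comp_continuous.
- by move=> p; rewrite cos2Dsin2.
have {}thP p : c (K (clamp_square p)) = cos (th p) /\
    s (K (clamp_square p)) = sin (th p).
  have [r r0 [e1 e2]] := thP p.
  suff r1 : r = 1 by rewrite e1 e2 r1 !mul1r.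
  have : (r * cos (th p)) ^+ 2 + (r * sin (th p)) ^+ 2 = 1.
    by rewrite -e1 -e2; exact: cos2Dsin2.
  rewrite !exprMn -mulrDr cos2Dsin2 mulr1 => /eqP.
  by rewrite sqrp_eq1 ?ltW// => /eqP.
have c0 : clamp01 0 = 0 :> R by rewrite clamp01_id// lexx ler01.
have c1 : clamp01 1 = 1 :> R by rewrite clamp01_id// lexx ler01.
have cpath (a b : R -> R) : continuous a -> continuous b ->
    continuous (fun s => th (a s, b s)).
  by move=> ca cb; apply: comp_continuous => //; exact: pair_continuous.
(* Two lifts of one path on the circle differ by a constant. *)
have same (a b : R -> R) : continuous a -> continuous b ->
    (forall r, cos (a r) = cos (b r) /\ sin (a r) = sin (b r)) ->
    a 1 - a 0 = b 1 - b 0.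
  move=> ca cb ab.
  have : (a 1 - b 1) / (2 * pi) = (a 0 - b 0) / (2 * pi).
    apply: (int_valued_constant (fun r => (a r - b r) / (2 * pi))).
      by apply: realM_continuous; [exact: realB_continuous|exact: cc].
    by move=> r; have [] := ab r; exact: same_angle_int.
  move/(congr1 (fun u => u * (2 * pi))); rewrite !divfK//; lra.
(* The two vertical sides of the square have the same image on the torus. *)
have side : th (1, 1) - th (1, 0) = th (0, 1) - th (0, 0).
  apply: (same (fun t => th (1, t)) (fun t => th (0, t))).
  + by apply: cpath; (exact: cc || exact: cid).
  + by apply: cpath; (exact: cc || exact: cid).
  move=> t; have [<- <-] := thP (1, t); have [<- <-] := thP (0, t).
  by rewrite /K /clamp_square /= c0 c1 seg0 seg1 torus_projD.
have bottom : th (1, 0) - th (0, 0) =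
    2 * pi * pr (F (x + y)) - 2 * pi * pr (F x).
  have := same (fun r => th (r, 0))
    (fun r => 2 * pi * pr (F (seg x y (clamp01 r)))).
  rewrite c0 c1 seg0 seg1; apply; first by apply: cpath; (exact: cc || exact: cid).
    apply: realM_continuous; [exact: cc|do 2 apply: comp_continuous => //].
    by apply: seg_continuous; exact: clamp01_continuous.
  move=> r; have [<- <-] := thP (r, 0).
  by rewrite /K /clamp_square /= c0 clamp01_id ?lexx ?ler01// H0 -Ff; exact: cs_proj.
have top : th (1, 1) - th (0, 1) = 2 * pi * pr (x + y) - 2 * pi * pr x.
  have := same (fun r => th (r, 1)) (fun r => 2 * pi * pr (seg x y (clamp01 r))).
  rewrite c0 c1 seg0 seg1; apply; first by apply: cpath; (exact: cc || exact: cid).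
    apply: realM_continuous; [exact: cc|apply: comp_continuous => //].
    by apply: seg_continuous; exact: clamp01_continuous.
  move=> r; have [<- <-] := thP (r, 1).
  by rewrite /K /clamp_square /= c1 clamp01_id ?lexx ?ler01// H1; exact: cs_proj.
have pry : pr (x + y) = pr x + pr y by rewrite -seg1 pr_seg mul1r.
apply/eqP; rewrite -subr_eq0.
have : 2 * pi * (pr (F (x + y)) - (pr (F x) + pr y)) = 0.
  by move: top; rewrite pry; lra.
by move/eqP; rewrite mulf_eq0 (negPf pi2).
Qed.

Definition commutes_with_translations (F : R * R -> R * R) :=
  forall x w, F (x + vec_of_int R w) = F x + vec_of_int R w.

Lemma lift_commutes_with_translations (f : homeo (torus R))
    (ft : homeo (R * R)%type) :
  Homeo0 f -> is_lift ft f -> commutes_with_translations ft.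
Proof.
move=> f0 fft x w; apply: injective_projections.
- apply: (homotopic_lift_translation f ft fst) => //.
  + exact: homeo_fun_continuous.
  + exact/fst_continuous/id_continuous.
  + by move=> y z /torus_projP[].
- apply: (homotopic_lift_translation f ft snd) => //.
  + exact: homeo_fun_continuous.
  + exact/snd_continuous/id_continuous.
  + by move=> y z /torus_projP[].
Qed.

(** Along every segment, both coordinates of the difference of the two maps are
    continuous functions with integral values. *)
Lemma lifts_differ_by_translation (A B : R * R -> R * R) :
  continuous A -> continuous B ->
  (forall x, torus_proj (A x) = torus_proj (B x)) ->
  exists w, forall x, A x = B x + vec_of_int R w.
Proof.
move=> cA cB AB.
have const (pr : R * R -> R) : continuous pr ->
    (forall x, pr (A x) - pr (B x) \is a Num.int) ->
    forall x, pr (A x) - pr (B x) = pr (A 0) - pr (B 0).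
  move=> cpr prAB x.
  have := int_valued_constant (fun s => pr (A (seg 0 x s)) - pr (B (seg 0 x s))).
  have cs : continuous (seg 0 x) by apply: seg_continuous; exact: id_continuous.
  move=> /(_ _ _ 1 0); rewrite seg0 seg1 add0r; apply=> //.
  by apply: realB_continuous; do 2 (apply: comp_continuous => //).
have [/intrP[m em] /intrP[n en]] := (torus_projP _ _).1 (AB 0).
exists (m, n) => x; have [i1 i2] : (forall x, (A x).1 - (B x).1 \is a Num.int) /\
    (forall x, (A x).2 - (B x).2 \is a Num.int).
  by split=> z; have /torus_projP[] := AB z.
have e1 := const fst (fst_continuous _ id_continuous) i1 x.
have e2 := const snd (snd_continuous _ id_continuous) i2 x.
apply: injective_projections => /=; [rewrite -em -e1|rewrite -en -e2]; lra.
Qed.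

End Torus.

(** * Coordinates relative to the annular direction, and barriers *)

Section Coordinates.
Context {R : realType} (v : int * int).
Hypothesis v_neq0 : v != (0, 0).
Implicit Types (x y : R * R) (w : int * int) (j : int).

Local Notation vec := (vec_of_int R).

(** The coordinates of a point relative to [v] and its orthogonal, both
    multiplied by the length of [v]: integral translations then move them by
    integers, and the translations [shift_along j] and [shift_across j] by
    multiples of the squared length. *)
Definition along x : R := dot x (vec v).
Definition across x : R := dot x (perp (vec v)).
Definition sqlen : R := dot (vec v) (vec v).
Definition shift_along j : int * int := (v.1 * j, v.2 * j).
Definition shift_across j : int * int := (- v.2 * j, v.1 * j).

Lemma vecD w w' : vec (w + w') = vec w + vec w'.
Proof. by rewrite /vec_of_int /= !intrD. Qed.

Lemma vecN w : vec (- w) = - vec w.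
Proof. by rewrite /vec_of_int /= !intrN. Qed.

Lemma sqlen_ge1 : 1 <= sqlen.
Proof.
rewrite /sqlen /dot /= -!intrM -intrD (ler_int R 1).
rewrite -gtz0_ge1 -!expr2 lt_neqAle eq_sym paddr_eq0 ?sqr_ge0// !sqrf_eq0.
rewrite addr_ge0 ?sqr_ge0// andbT.
by move: v_neq0; rewrite -pair_eqE.
Qed.

Lemma alongD x y : along (x + y) = along x + along y.
Proof. by rewrite /along /dot /=; ring. Qed.

Lemma acrossD x y : across (x + y) = across x + across y.
Proof. by rewrite /across /dot /=; ring. Qed.

Lemma alongN x : along (- x) = - along x.
Proof. by rewrite /along /dot /=; ring. Qed.

Lemma acrossN x : across (- x) = - across x.
Proof. by rewrite /across /dot /=; ring. Qed.

Lemma along_seg x y (s : R) : along (seg x y s) = along x + s * along y.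
Proof. by rewrite /along /dot /=; ring. Qed.

Lemma across_seg x y (s : R) : across (seg x y s) = across x + s * across y.
Proof. by rewrite /across /dot /=; ring. Qed.

Lemma along_shift_along j : along (vec (shift_along j)) = sqlen * j%:~R.
Proof. by rewrite /along /sqlen /dot /= !intrM; ring. Qed.

Lemma across_shift_along j : across (vec (shift_along j)) = 0.
Proof. by rewrite /across /dot /= !intrM; ring. Qed.

Lemma along_shift_across j : along (vec (shift_across j)) = 0.
Proof. by rewrite /along /dot /= !intrM !intrN; ring. Qed.

Lemma across_shift_across j : across (vec (shift_across j)) = sqlen * j%:~R.
Proof. by rewrite /across /sqlen /dot /= !intrM !intrN; ring. Qed.

Lemma along_across_sqr x : along x ^+ 2 + across x ^+ 2 = sqlen * dot x x.
Proof. by rewrite /across /along /sqlen /dot /=; ring. Qed.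

Lemma along_across_inj x y : along x = along y -> across x = across y -> x = y.
Proof.
move=> e1 e2; apply/eqP; rewrite -subr_eq0; apply/eqP.
have := along_across_sqr (x - y).
rewrite alongD acrossD alongN acrossN e1 e2 !subrr expr0n addr0 => /esym/eqP.
rewrite mulf_eq0 (gt_eqF (lt_le_trans ltr01 sqlen_ge1)) /=.
rewrite /dot /= -!expr2 paddr_eq0 ?sqr_ge0// !sqrf_eq0 => /andP[/eqP d1 /eqP d2].
exact: injective_projections.
Qed.

Lemma dot_continuous (u : R * R) : continuous (fun x => dot x u).
Proof.
have cc (a : R) : continuous (fun _ : R * R => a) by move=> ?; exact: cvg_cst.
have c1 := fst_continuous (fun x : R * R => x) id_continuous.
have c2 := snd_continuous (fun x : R * R => x) id_continuous.
by apply: realD_continuous; apply: realM_continuous.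
Qed.

Lemma along_continuous : continuous along. Proof. exact: dot_continuous. Qed.
Lemma across_continuous : continuous across. Proof. exact: dot_continuous. Qed.

Lemma next_multiple (c : R) : exists j, c < sqlen * j%:~R <= c + sqlen.
Proof.
have L0 : 0 < sqlen := lt_le_trans ltr01 sqlen_ge1.
have /andP[h1 h2] : (Num.floor (c / sqlen))%:~R <= c / sqlen <
    (Num.floor (c / sqlen) + 1)%:~R.
  exact: floor_itv.
exists (Num.floor (c / sqlen) + 1); rewrite mulrC -ltr_pdivrMr// h2 /=.
by move: h1; rewrite intrD mulrDl mul1r lerD2r ler_pdivlMr.
Qed.

(** What is used of the iterates of the annular lift, with [G] an iterate of the
    other lift and one constant [M] for all of them. *)
Definition annular_commuting (M : R) (G F : R * R -> R * R) :=
  [/\ continuous F, injective F, commutes_with_translations F,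
      forall x, `|across (F x - x)| <= M &
      exists2 w, across (vec w) = 0 & forall x, F (G x) = G (F x) + vec w].

(** The core of the argument. If [G x0] lies far above [G y0] although [x0]
    is below the strip of heights between 0 and [M] and [y0] above it, the
    images under [G] of a ray going down from [x0] and of a ray going up from
    [y0] are interlaced over a band of heights much wider than [M]. An [F] as
    above cannot make these two paths [alpha] and [beta], nor any translates of
    them along [v], meet: before [G] is applied, their points stay on
    opposite sides of the strip. As [beta] crosses the band, its translates cut
    the band into cells of bounded width, and the image under [F] of the part of
    [alpha] inside the band remains in one cell. As that image crosses the
    band in turn, its translates confine the image of every horizontal segment
    that starts on [alpha]. Thus [F] moves all points by nearly the same amount
    along [v], with a bound that depends on [alpha] and [beta] only. *)
Lemma uniform_deviation (M : R) (G : R * R -> R * R) x0 y0 :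
  0 < M -> continuous G -> injective G -> commutes_with_translations G ->
  across x0 <= 0 -> M < across y0 ->
  across (G y0) + 10 * M + sqlen <= across (G x0) ->
  exists C : R, forall F, annular_commuting M G F ->
    forall x y, `|along (F x - x) - along (F y - y)| <= C.
Proof.
move=> M0 cG iG tG x0_low y0_high gap.
have L1 := sqlen_ge1; set L := sqlen in L1 gap.
set a := across (G y0) in gap *; set b := across (G x0) in gap *.
(* The length of the rays is chosen so that their images cross all heights from
   [a] to [b]. *)
have [K /andP[K1 _]] := next_multiple (b - a); rewrite -/L in K1.
have cid (T : topologicalType) : continuous (fun z : T => z) by exact: id_continuous.
have cc (T : topologicalType) (c : R) : continuous (fun _ : T => c).
  by move=> ?; exact: cvg_cst.
pose p (s : R) := seg x0 (vec (shift_across (- K))) s.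
pose q (s : R) := seg y0 (vec (shift_across K)) s.
pose alpha s := G (p s).
pose beta s := G (q s).
have c_alpha : continuous alpha by apply: comp_continuous => //; exact: seg_continuous.
have c_beta : continuous beta by apply: comp_continuous => //; exact: seg_continuous.
have K0 : 0 <= L * K%:~R by lra.
have p_low (s : R) : 0 <= s -> across (p s) <= 0.
  move=> s0; rewrite /p across_seg across_shift_across intrN.
  have := mulr_ge0 s0 K0; rewrite -/L; lra.
have q_high (s : R) : 0 <= s -> M < across (q s).
  move=> s0; rewrite /q across_seg across_shift_across.
  have := mulr_ge0 s0 K0; rewrite -/L; lra.
have alpha0 : across (alpha 0) = b by rewrite /alpha /p seg0.
have alpha1 : across (alpha 1) < a.
  by rewrite /alpha /p seg1 tG acrossD across_shift_across intrN -/b -/L; lra.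
have beta0 : across (beta 0) = a by rewrite /beta /q seg0.
have beta1 : b < across (beta 1).
  by rewrite /beta /q seg1 tG acrossD across_shift_across -/a -/L; lra.
have no_meet F (s t : R) j : annular_commuting M G F -> 0 <= s -> 0 <= t ->
    F (alpha s) <> beta t + vec (shift_along j).
  move=> [_ _ tF F_ann [w w0 FG]] s0 t0; rewrite /alpha FG => /eqP.
  rewrite eq_sym -subr_eq -addrA -vecN -vecD -tG => /eqP /iG e.
  have := F_ann (p s); rewrite acrossD acrossN -e acrossD vecD vecN.
  rewrite acrossD acrossN w0 across_shift_along ler_norml => /andP[_].
  by have := p_low s s0; have := q_high t t0; lra.
have [Ca Ca0 alphaC] := bounded_on_unit _
  (comp_continuous _ _ c_alpha along_continuous).
have [Cb Cb0 betaC] := bounded_on_unit _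
  (comp_continuous _ _ c_beta along_continuous).
pose C0 : R := Ca + Cb.
have {}alphaC (s : R) : 0 <= s <= 1 -> - C0 <= along (alpha s) <= C0.
  by move=> /alphaC; rewrite ler_norml /C0 => /andP[? ?]; apply/andP; lra.
have {}betaC (s : R) : 0 <= s <= 1 -> - C0 <= along (beta s) <= C0.
  by move=> /betaC; rewrite ler_norml /C0 => /andP[? ?]; apply/andP; lra.
have [||||| s1 [s2 [/andP[s10 s12] s21] [gs1 gs2 gs]]] :=
  crossing_interval (fun s : R => across (alpha s)) (a + 2 * M) (b - 2 * M) 1.
- exact: comp_continuous across_continuous.
- exact: ler01.
- lra.
- by rewrite alpha0; lra.
- lra.
pose C1 : R := 2 * C0 + L.
have in01 (s : R) : s1 <= s <= s2 -> 0 <= s <= 1 by move=> /andP[? ?]; apply/andP; lra.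
have s1in : s1 <= s1 <= s2 by rewrite lexx.
have s2in : s1 <= s2 <= s2 by rewrite lexx s12.
have conv (s s' t : R) : s1 <= s <= s2 -> s1 <= s' <= s2 -> 0 <= t <= 1 ->
    s1 <= s + t * (s' - s) <= s2.
  move=> /andP[h1 h2] /andP[h3 h4] /andP[h5 h6]; apply/andP; split; nra.
(* The image under [F] of the part of [alpha] inside the band does not spread
   along [v]: otherwise some translate of [beta] would separate two of its
   points. *)
have tube F (s s' : R) : annular_commuting M G F -> s1 <= s <= s2 -> s1 <= s' <= s2 ->
    along (F (alpha s')) <= along (F (alpha s)) + C1.
  move=> HF ss ss'; have [cF _ _ F_ann _] := HF.
  rewrite leNgt; apply/negP => far.
  have [j /andP[j1 j2]] := next_multiple (along (F (alpha s)) + C0).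
  rewrite -/L in j1 j2.
  have c_path : continuous (fun t : R => F (alpha (s + t * (s' - s)))).
    do 2 apply: comp_continuous => //.
    by apply: realD_continuous => //; apply: realM_continuous => //.
  have [||||t u|t [u [/andP[t0 t1] /andP[u0 u1]] [e1 e2]]] := paths_cross
    (fun t : R => along (beta t) + L * j%:~R) (fun t : R => across (beta t))
    (fun t : R => along (F (alpha (s + t * (s' - s)))))
    (fun t : R => across (F (alpha (s + t * (s' - s))))).
  - apply: realD_continuous => //; exact: comp_continuous along_continuous.
  - exact: comp_continuous across_continuous.
  - exact: comp_continuous along_continuous.
  - exact: comp_continuous across_continuous.
  - move=> t01 u01; have := gs _ (conv _ _ _ ss ss' u01).
    have := F_ann (alpha (s + u * (s' - s))); rewrite acrossD acrossN ler_norml.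
    move=> /andP[h1 h2] /andP[h3 h4].
    have /andP[h5 h6] := betaC _ t01.
    rewrite beta0 mul0r addr0 mul1r subrKC; move: far; rewrite /C1 => far; split; lra.
  apply: (no_meet F (s + u * (s' - s)) t j HF) => //.
    by have /in01/andP[] : s1 <= s + u * (s' - s) <= s2 by apply: conv; rewrite ?u0.
  apply: along_across_inj; rewrite ?alongD ?acrossD
      ?along_shift_along ?across_shift_along -/L.
    by rewrite e1.
  by rewrite addr0 e2.
pose C2 : R := 2 * C1 + L.
pose c : R := a + 5 * M.
(* A margin of [5 * M] keeps the [F]-image of the segment [sigma] at
   heights that the [F]-image of the part of [alpha] crosses entirely. *)
have horizontal F z (s : R) : annular_commuting M G F ->
    0 <= along z <= L -> c <= across z <= c + L ->
    s1 <= s <= s2 -> across (alpha s) = across z ->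
    `|along (F z) - along (F (alpha s))| <= C2.
  move=> HF /andP[z0 zL] /andP[zc zcL] ss es; have [cF iF tF F_ann _] := HF.
  have /andP[ws1 ws2] := alphaC _ (in01 _ ss).
  have [j /andP[j1 j2]] := next_multiple C1; rewrite -/L in j1 j2.
  pose sigma t := seg (alpha s) (z - alpha s) t.
  have c_sigma : continuous sigma by exact: seg_continuous.
  have sigma_across t : across (sigma t) = across z.
    by rewrite /sigma across_seg acrossD acrossN es; ring.
  have sigma0 : sigma 0 = alpha s by rewrite /sigma seg0.
  have sigma1 : sigma 1 = z by rewrite /sigma seg1 subrKC.
  have sigma_along (t : R) : 0 <= t <= 1 -> - C0 <= along (sigma t) <= C0 + L.
    move=> /andP[t0 t1]; rewrite /sigma along_seg alongD alongN; apply/andP; split; nra.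
  have Fsigma t : across z - M <= across (F (sigma t)) <= across z + M.
    have := F_ann (sigma t); rewrite acrossD acrossN ler_norml sigma_across.
    by move=> /andP[? ?]; apply/andP; lra.
  have c_gamma : continuous (fun t : R => F (alpha (s2 + t * (s1 - s2)))).
    do 2 apply: comp_continuous => //.
    by apply: realD_continuous => //; apply: realM_continuous => //.
  have c_Fsigma : continuous (fun t : R => F (sigma t)) by exact: comp_continuous.
  have separated (i : int) (t u : R) : 0 <= t <= 1 -> s1 <= u <= s2 ->
      C1 < L * i%:~R \/ L * i%:~R < - C1 ->
      F (sigma t) <> F (alpha u) + vec (shift_along i).
    move=> t01 uin i_far; rewrite -tF => /iF /(congr1 along).
    rewrite alongD along_shift_along -/L.
    have /andP[? ?] := sigma_along _ t01; have /andP[? ?] := alphaC _ (in01 _ uin).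
    by move: i_far; rewrite /C1; lra.
  have top : b - 3 * M <= across (F (alpha s1)).
    by have := F_ann (alpha s1); rewrite acrossD acrossN gs1 ler_norml;
      move=> /andP[? ?]; lra.
  have bot : across (F (alpha s2)) <= a + 3 * M.
    by have := F_ann (alpha s2); rewrite acrossD acrossN gs2 ler_norml;
      move=> /andP[? ?]; lra.
  (* The two values of [e] give the bounds on the two sides of
     [alpha s]; the barrier is the translate by [j], respectively [- j], which
     [sigma] does not reach. *)
  have mono (e : bool) (i := if e then j else - j)
      (sg : R := if e then 1 else -1) :
      sg * (along (F z) - along (F (alpha s))) <= C2.
    have sg0 : sg != 0 by rewrite /sg; case: (e); rewrite ?oppr_eq0 oner_eq0.
    have ei : sg * (L * i%:~R) = L * j%:~R.
      by rewrite /sg /i; case: (e); rewrite ?intrN; ring.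
    rewrite leNgt; apply/negP => far.
    have [||||t u|t [u [t01 u01] [e1 e2]]] := paths_cross
      (fun t : R => sg * (along (F (alpha (s2 + t * (s1 - s2)))) + L * i%:~R))
      (fun t : R => across (F (alpha (s2 + t * (s1 - s2)))))
      (fun t : R => sg * along (F (sigma t)))
      (fun t : R => across (F (sigma t))).
    - apply: realM_continuous => //; apply: realD_continuous => //.
      exact: comp_continuous along_continuous.
    - exact: comp_continuous across_continuous.
    - apply: realM_continuous => //; exact: comp_continuous along_continuous.
    - exact: comp_continuous across_continuous.
    - move=> t01 u01; have /andP[? ?] := Fsigma u.
      rewrite mul0r addr0 mul1r subrKC sigma0 sigma1.
      rewrite (mulrDr sg (along (F (alpha (s2 + t * (s1 - s2)))))) ei.
      have tin := conv _ _ _ s2in s1in t01.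
      have := tube F _ _ HF tin ss; have := tube F _ _ HF ss tin.
      move: far zc zcL; rewrite /sg /C2 /c; case: (e) => far zc zcL h1 h2.
        by split; lra.
      by split; lra.
    apply: (separated i u (s2 + t * (s1 - s2)) u01 (conv _ _ _ s2in s1in t01)).
      by rewrite /i; case: (e); rewrite ?intrN; [left|right]; lra.
    apply: along_across_inj; rewrite ?alongD ?acrossD
      ?along_shift_along ?across_shift_along -/L.
      by apply: (mulfI sg0); rewrite e1.
    by rewrite addr0 e2.
  have := mono true; have := mono false; rewrite /= ler_norml => h1 h2.
  by apply/andP; split; lra.
pose C3 : R := C1 + C2 + L.
have reference F z : annular_commuting M G F ->
    `|along (F z - z) - along (F (alpha s1))| <= C3.
  move=> HF; have [cF iF tF F_ann _] := HF.
  have [i /andP[i1 i2]] := next_multiple (- along z).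
  have [k /andP[k1 k2]] := next_multiple (c - across z).
  rewrite -/L in i1 i2 k1 k2; have cE : c = a + 5 * M by [].
  (* [F] commutes with integral translations, so [z] may be moved into the
     fundamental domain where the previous bound applies. *)
  pose w := shift_along i + shift_across k.
  have z'_along : along (z + vec w) = along z + L * i%:~R.
    by rewrite /w vecD !alongD along_shift_along along_shift_across addr0.
  have z'_across : across (z + vec w) = across z + L * k%:~R.
    by rewrite /w vecD !acrossD across_shift_along across_shift_across add0r.
  have [|||s] := intermediate_value
    (fun s : R => across (alpha s)) s1 s2 (across (z + vec w)).
  - exact: comp_continuous across_continuous.
  - exact: s12.
  - rewrite gs1 gs2 z'_across ge_min le_max; apply/andP; split; apply/orP.
      by right; lra.
    by left; lra.
  move=> ss es.
  have /ler_normlP[h1 h2] :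
      `|along (F (z + vec w)) - along (F (alpha s))| <= C2.
    by apply: horizontal => //; rewrite ?z'_along ?z'_across; apply/andP; split; lra.
  have := tube F _ _ HF s1in ss; have := tube F _ _ HF ss s1in.
  have -> : F z - z = F (z + vec w) - (z + vec w)
    by rewrite tF opprD addrACA subrr addr0.
  rewrite alongD alongN z'_along => h3 h4; rewrite ler_norml /C3; apply/andP; split; lra.
exists (2 * C3) => F HF x y.
have := reference F x HF; have := reference F y HF.
rewrite !ler_norml => /andP[? ?] /andP[? ?]; apply/andP; split; lra.
Qed.

End Coordinates.

(** * Iterates, commutators and deviations *)

Section Iterates.
Context {R : realType} (v : int * int).
Implicit Types (F G : R * R -> R * R) (f : homeo (R * R)%type).

Local Notation vec := (vec_of_int R).
Local Notation across := (@across R v).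
Local Notation along := (@along R v).

Definition commutes_up_to_along F G :=
  exists2 w, across (vec w) = 0 & forall x, F (G x) = G (F x) + vec w.

Lemma commutes_up_to_alongC F G :
  commutes_up_to_along F G -> commutes_up_to_along G F.
Proof.
move=> [w w0 FG]; exists (- w) => [|x]; first by rewrite vecN acrossN w0 oppr0.
by rewrite FG vecN addrK.
Qed.

Lemma commutes_with_translations_iter F n :
  commutes_with_translations F -> commutes_with_translations (iter n F).
Proof. by move=> tF; elim: n => [|n IHn] x w //=; rewrite IHn tF. Qed.

Lemma iter_commutator F G w n : commutes_with_translations F ->
  (forall x, F (G x) = G (F x) + vec w) ->
  forall x, iter n F (G x) = G (iter n F x) + vec (w *+ n).
Proof.
move=> tF FG x; elim: n => [|n IHn]; first by rewrite /vec_of_int /= addr0.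
by rewrite iterS IHn tF FG mulrS vecD addrA.
Qed.

Lemma across_mulrn w n : across (vec (w *+ n)) = across (vec w) *+ n.
Proof.
elim: n => [|n IHn]; first by rewrite /across /dot /= !mul0r addr0.
by rewrite !mulrS vecD acrossD IHn.
Qed.

Lemma commutes_up_to_along_iter F G n :
  commutes_with_translations F -> commutes_up_to_along F G ->
  commutes_up_to_along (iter n F) G.
Proof.
move=> tF [w w0 FG]; exists (w *+ n); first by rewrite across_mulrn w0 mul0rn.
exact: iter_commutator.
Qed.

Lemma commutes_with_translations_inv f :
  commutes_with_translations f -> commutes_with_translations (homeo_inv f).
Proof.
by move=> tf x w; rewrite -{1}(homeo_invK f x) -tf homeo_funK.
Qed.

Lemma commutes_up_to_along_inv f G : commutes_with_translations f ->
  commutes_up_to_along f G -> commutes_up_to_along (homeo_inv f) G.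
Proof.
move=> tf [w w0 fG]; exists (- w) => [|x].
  by rewrite vecN acrossN w0 oppr0.
set y := homeo_inv f x; have -> : x = f y by rewrite homeo_invK.
by rewrite -[G (f y)](addrK (vec w)) -fG -vecN -tf homeo_funK.
Qed.

Lemma iterz_closed (P : (R * R -> R * R) -> Prop) f :
  (forall n, P (iter n f)) -> (forall n, P (iter n (homeo_inv f))) ->
  forall n, P (iterz f n).
Proof. by move=> Pf Pi [n|n]; [exact: Pf|exact: Pi]. Qed.

Lemma commutes_with_translations_iterz f n :
  commutes_with_translations f -> commutes_with_translations (iterz f n).
Proof.
move=> tf; apply: (iterz_closed commutes_with_translations) => k.
  exact: commutes_with_translations_iter.
exact/commutes_with_translations_iter/commutes_with_translations_inv.
Qed.

Lemma commutes_up_to_along_iterz f G n : commutes_with_translations f ->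
  commutes_up_to_along f G -> commutes_up_to_along (iterz f n) G.
Proof.
move=> tf fG; apply: (iterz_closed (fun F => commutes_up_to_along F G)) => k.
  exact: commutes_up_to_along_iter.
apply: commutes_up_to_along_iter; first exact: commutes_with_translations_inv.
exact: commutes_up_to_along_inv.
Qed.

Lemma iterz_continuous f n : continuous (iterz f n).
Proof.
have H F k : continuous F -> continuous (iter k F).
  move=> cF; elim: k => [|k IHk]; first by move=> x; exact: cvg_id.
  exact: (comp_continuous (iter k F) F).
by apply: (iterz_closed (fun F => continuous F)) => k; apply: H;
  [exact: homeo_fun_continuous|exact: homeo_inv_continuous].
Qed.

Lemma iterz_injective f n : injective (iterz f n).
Proof.
have H F k : injective F -> injective (iter k F).
  by move=> iF; elim: k => [//|k IHk] x y /iF /IHk.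
by apply: (iterz_closed (fun F => injective F)) => k; apply: H;
  [exact: can_inj (homeo_funK f)|exact: can_inj (homeo_invK f)].
Qed.

(** The displacement is invariant under integral translations, hence determined
    by its values on the compact unit square. *)
Lemma bounded_displacement G : continuous G -> commutes_with_translations G ->
  exists B : R, forall x, `|across (G x - x)| <= B.
Proof.
move=> cG tG; pose phi x := `|across (G x) - across x|.
have cphi : continuous phi.
  apply: comp_continuous; last exact: norm_continuous.
  apply: realB_continuous; last exact: across_continuous.
  exact: comp_continuous (across_continuous _).
have cK : compact (`[0%R, 1%R]%classic `*` `[0%R, 1%R]%classic : set (R * R)).
  by apply: compact_setX; exact: segment_compact.
have [|z _ zmax] := compact_EVT_max _ cK (continuous_subspaceT cphi).
  by exists (0, 0); split; rewrite /= in_itv /= lexx ler01.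
exists (phi z) => x.
have frac (r : R) : 0 <= r + (- Num.floor r)%:~R <= 1.
  have /andP[] : (Num.floor r)%:~R <= r < (Num.floor r + 1)%:~R by exact: floor_itv.
  rewrite intrN intrD => ? ?; apply/andP; lra.
pose w : int * int := (- Num.floor x.1, - Num.floor x.2).
have -> : G x - x = G (x + vec w) - (x + vec w).
  by rewrite tG opprD addrACA subrr addr0.
rewrite acrossD acrossN; apply: zmax; apply/mem_set.
by split; rewrite /= in_itv /=; exact: frac.
Qed.

(** The [n]-th iterate of [F] commutes with [G] up to [n] times [w]; its height
    stays bounded because the iterates of [F] and the single map [G] displace
    heights by a bounded amount, so the height of [w] vanishes. *)
Lemma commutator_along (M : R) F G w :
  (forall n x, `|across (iter n F x - x)| <= M) ->
  continuous G -> commutes_with_translations F -> commutes_with_translations G ->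
  (forall x, F (G x) = G (F x) + vec w) -> across (vec w) = 0.
Proof.
move=> F_ann cG tF tG FG.
have [B G_bd] := bounded_displacement G cG tG.
have bound n : `|across (vec w)| *+ n <= 2 * M + 2 * B.
  rewrite -normrMn -across_mulrn.
  have := iter_commutator F G w n tF FG 0 => /(congr1 across).
  rewrite acrossD.
  have := F_ann n (G 0); have := F_ann n 0.
  have := G_bd 0; have := G_bd (iter n F 0).
  rewrite !acrossD !acrossN !ler_norml => /andP[? ?] /andP[? ?] /andP[? ?] /andP[? ?] ?.
  by apply/andP; lra.
apply/eqP/negP => /negP; rewrite -normr_gt0 => w0.
have B0 : 0 <= (2 * M + 2 * B) / `|across (vec w)|.
  by apply: divr_ge0; [exact: bound 0%N|exact: ltW].
have := archi_boundP B0; rewrite ltr_pdivrMr// (mulr_natl `|across (vec w)|) ltNge.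
by rewrite bound.
Qed.

End Iterates.

Section Deviations.
Context {R : realType} (v : int * int).
Hypothesis v_neq0 : v != (0, 0).
Implicit Types (f : homeo (R * R)%type).
Local Notation vec := (vec_of_int R).
Local Notation across := (@across R v).
Local Notation along := (@along R v).

Lemma enorm_le_along_across (x : R * R) : enorm x <= `|along x| + `|across x|.
Proof.
have L1 := @sqlen_ge1 R v v_neq0.
have dx0 : 0 <= dot x x by rewrite /dot -!expr2 addr_ge0 ?sqr_ge0.
have s0 : 0 <= `|along x| + `|across x| by rewrite addr_ge0.
rewrite /enorm -(ger0_norm s0) -sqrtr_sqr ler_wsqrtr//.
apply: (@le_trans _ _ (sqlen v * dot x x)); first by rewrite ler_peMl.
rewrite -along_across_sqr -(real_normK (num_real (along x))).
rewrite -(real_normK (num_real (across x))) sqrrD lerD2r lerDl.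
by rewrite mulrn_wge0// mulr_ge0.
Qed.

Lemma Desv_finite f (A B : R) :
  (forall n x y, `|along (iterz f n x - x) - along (iterz f n y - y)| <= A) ->
  (forall n x, `|across (iterz f n x - x)| <= B) ->
  (Desv f < +oo)%E.
Proof.
move=> hA hB; apply: (@le_lt_trans _ _ (A + (B + B))%:E); last exact: ltry.
apply: ge_ereal_sup => _ [n [x [y ->]]]; rewrite lee_fin.
apply: le_trans (enorm_le_along_across _) _.
rewrite alongD acrossD alongN acrossN lerD//.
by apply: le_trans (ler_normB _ _) _; rewrite lerD.
Qed.

Lemma Desv_dir_finite f (A : R) :
  (forall n x y, across (iterz f n x - x) - across (iterz f n y - y) <= A) ->
  (Desv_dir (perp (vec v)) f < +oo)%E.
Proof.
move=> hA; apply: (@le_lt_trans _ _ (A / enorm (perp (vec v)))%:E); last exact: ltry.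
apply: ge_ereal_sup => _ [n [x [y ->]]]; rewrite lee_fin /Pr normrM.
have e0 : 0 <= (enorm (perp (vec v)))^-1 by rewrite invr_ge0 sqrtr_ge0.
rewrite [`|_^-1|]ger0_norm// ler_wpM2r// -/(across _) acrossD acrossN ler_norml.
by apply/andP; have := hA n x y; have := hA n y x; split; lra.
Qed.

End Deviations.

Theorem theorem1p2 (R : realType) (f h : homeo (torus R))
    (ft ht : homeo (R * R)%type) (v : int * int) :
  Homeo0 f -> Homeo0 h ->
  (forall p, f (h p) = h (f p)) ->
  is_lift ft f -> is_lift ht h ->
  v != (0, 0) ->
  annular v ft ->
  (Desv_dir (perp (vec_of_int R v)) ht < +oo)%E \/ (Desv ft < +oo)%E.
Proof.
move=> f0 h0 fh ftf hth v0 [M M0 ft_ann].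
have {}ft_ann n x : `|across v (iterz ft n x - x)| <= M by exact: ft_ann.
have tf := lift_commutes_with_translations f ft f0 ftf.
have th := lift_commutes_with_translations h ht h0 hth.
have cf : continuous ft by exact: homeo_fun_continuous.
have ch : continuous ht by exact: homeo_fun_continuous.
have comm : commutes_up_to_along v ft ht.
  have [||x|w fthw] := lifts_differ_by_translation
      (fun x => ft (ht x)) (fun x => ht (ft x)).
  - exact: comp_continuous.
  - exact: comp_continuous.
  - by rewrite ftf hth fh -ftf -hth.
  exists w => //; apply: (commutator_along v M ft ht w _ ch tf th fthw) => n x.
  exact: (ft_ann n%:Z).
pose L : R := sqlen v.
pose D n x y := across v (iterz ht n x - x) - across v (iterz ht n y - y).
(* Either the deviations of [ht] across [v] are bounded by an explicit constant,
   or one of them is large enough for the core argument: of this constant,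
   [M + 2 * L] is lost when the two points are moved by translations to
   the right sides of the strip. *)
have [small|/existsNP[m /existsNP[x' /existsNP[y' /negP]]]] :=
    pselect (forall n x y, D n x y <= 11 * M + 3 * L).
  by left; exact: Desv_dir_finite small.
rewrite -ltNge => large; right; pose G := iterz ht m.
have tG : commutes_with_translations G by exact: commutes_with_translations_iterz.
have L1 : 1 <= L by exact: sqlen_ge1.
have [i /andP[i1 i2]] := next_multiple v v0 (- across v x' - L).
have [j /andP[j1 j2]] := next_multiple v v0 (M - across v y').
rewrite -/L in i1 i2 j1 j2.
pose x := x' + vec_of_int R (shift_across v i).
pose y := y' + vec_of_int R (shift_across v j).
have xE : across v x = across v x' + L * i%:~R.
  by rewrite /x acrossD across_shift_across.
have yE : across v y = across v y' + L * j%:~R.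
  by rewrite /y acrossD across_shift_across.
have GxE : across v (G x) = across v (G x') + L * i%:~R.
  by rewrite /x tG acrossD across_shift_across.
have GyE : across v (G y) = across v (G y') + L * j%:~R.
  by rewrite /y tG acrossD across_shift_across.
move: large; rewrite /D !acrossD !acrossN -/G => large.
have [||||||C HC] := uniform_deviation v v0 M G x y M0.
- exact: iterz_continuous.
- exact: iterz_injective.
- exact: tG.
- by rewrite xE; lra.
- by rewrite yE; lra.
- by rewrite GxE GyE -/L; lra.
apply: (Desv_finite v v0 ft C M) => // n; apply: HC; split.
- exact: iterz_continuous.
- exact: iterz_injective.
- exact: commutes_with_translations_iterz.
- exact: ft_ann.
- apply: commutes_up_to_along_iterz => //.
  apply: commutes_up_to_alongC; apply: commutes_up_to_along_iterz => //.
  exact: commutes_up_to_alongC.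
Qed.
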